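(* Let $G$ be a finite-dimensional Lie group with Lie algebra $\mathfrak{g}$, acting on the left on a manifold $M$. Fix $a_{\rm ref}\in M$, and let $L_{d,a_{\rm ref}}:G\times G\times\mathbb{R}\times\mathbb{R}\to\mathbb{R}$ be a $G_{a_{\rm ref}}$-invariant discrete Lagrangian, $F^{{\rm ext}\pm}_{d,a_{\rm ref}},F^{{\rm fr}\pm}_{d,a_{\rm ref}}:G\times G\times\mathbb{R}\times\mathbb{R}\to T^*G$ be $G_{a_{\rm ref}}$-equivariant discrete external and friction forces, and $P_{d,a_{\rm ref}}:G\times G\times\mathbb{R}\times\mathbb{R}\to\mathbb{R}$ be the $G_{a_{\rm ref}}$-invariant discrete phenomenological constraint. Let $\mathsf{L}_d:G\times\operatorname{Orb}(a_{\rm ref})\times\mathbb{R}\times\mathbb{R}\to\mathbb{R}$, $\mathsf{F}^{{\rm ext}\pm}_d,\mathsf{F}^{{\rm fr}\pm}_d:G\times\operatorname{Orb}(a_{\rm ref})\times\mathbb{R}\times\mathbb{R}\to\mathfrak{g}^*$ and $\mathsf{P}_d:G\times\operatorname{Orb}(a_{\rm ref})\times\mathbb{R}\times\mathbb{R}\to\mathbb{R}$ be the associated reduced maps. Let $(g_d,S_d)=(g_k,S_k)_{0\le k\le N}$ be a discrete curve in $G\times\mathbb{R}$, and set $\Xi_k=g_k^{-1}g_{k+1}\in G$ and $a_k=g_k^{-1}a_{\rm ref}\in\operatorname{Orb}(a_{\rm ref})$. Then the following assertions are equivalent: (1) $(g_d,S_d)$ is critical for the discrete variational formulation $$\delta\sum_{k=0}^{N-1}L_{d,a_{\rm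 ref}}(g_k,g_{k+1},S_k,S_{k+1})+\sum_{k=0}^{N-1}\Big(\langle F^{{\rm ext}-}_{d,a_{\rm ref}}(g_k,g_{k+1},S_k,S_{k+1}),\delta g_k\rangle+\langle F^{{\rm ext}+}_{d,a_{\rm ref}}(g_k,g_{k+1},S_k,S_{k+1}),\delta g_{k+1}\rangle\Big)=0$$ for all variations $\delta g_d,\delta S_d$, with $\delta g_d$ vanishing at the endpoints, subject to the discrete variational constraint, for all $k\in\{0,\dots,N-1\}$, $$D_3L_{d,a_{\rm ref}}(g_k,g_{k+1},S_k,S_{k+1})\,\delta S_k+D_4L_{d,a_{\rm ref}}(g_k,g_{k+1},S_k,S_{k+1})\,\delta S_{k+1}$$ $$=\langle F^{{\rm fr}-}_{d,a_{\rm ref}}(g_k,g_{k+1},S_k,S_{k+1}),\delta g_k\rangle+\langle F^{{\rm fr}+}_{d,a_{\rm ref}}(g_k,g_{k+1},S_k,S_{k+1}),\delta g_{k+1}\rangle,$$ and $(g_d,S_d)$ satisfies the discrete phenomenological constraint $P_{d,a_{\rm ref}}(g_k,g_{k+1},S_k,S_{k+1})=0$ for all $k\in\{0,\dots,N-1\}$. (2) $(g_d,S_d)$ satisfies $$D_1L_{d,a_{\rm ref}}(g_k,g_{k+1},S_k,S_{k+1})+D_2L_{d,a_{\rm ref}}(g_{k-1},g_k,S_{k-1},S_k)$$ $$+(F^{{\rm ext}-}_{d,a_{\rm ref}}+F^{{\rm fr}-}_{d,a_{\rm ref}})(g_k,g_{k+1},S_k,S_{k+1})+(F^{{\rm ext}+}_{d,a_{\rm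 ref}}+F^{{\rm fr}+}_{d,a_{\rm ref}})(g_{k-1},g_k,S_{k-1},S_k)=0$$ for all $k\in\{1,\dots,N-1\}$, and $P_{d,a_{\rm ref}}(g_k,g_{k+1},S_k,S_{k+1})=0$ for all $k\in\{0,\dots,N-1\}$. (3) The discrete curve $(\Xi_d,a_d,S_d)$ is critical for the reduced discrete variational formulation $$\delta\sum_{k=0}^{N-1}\mathsf{L}_d(\Xi_k,a_k,S_k,S_{k+1})+\sum_{k=0}^{N-1}\Big(\langle\mathsf{F}^{{\rm ext}-}_d(\Xi_k,a_k,S_k,S_{k+1}),\eta_k\rangle+\langle\mathsf{F}^{{\rm ext}+}_d(\Xi_k,a_k,S_k,S_{k+1}),\eta_{k+1}\rangle\Big)=0$$ subject to the discrete variational and phenomenological constraints, for all $k\in\{0,\dots,N-1\}$, $$D_3\mathsf{L}_d(\Xi_k,a_k,S_k,S_{k+1})\,\delta S_k+D_4\mathsf{L}_d(\Xi_k,a_k,S_k,S_{k+1})\,\delta S_{k+1}$$ $$=\langle\mathsf{F}^{{\rm fr}-}_d(\Xi_k,a_k,S_k,S_{k+1}),\eta_k\rangle+\langle\mathsf{F}^{{\rm fr}+}_d(\Xi_k,a_k,S_k,S_{k+1}),\eta_{k+1}\rangle,$$ $$\mathsf{P}_d(\Xi_k,a_k,S_k,S_{k+1})=0,$$ and the discrete Euler–Poincaré constraints $$\delta\Xi_k=-T_eR_{\Xi_k}\eta_k+T_eL_{\Xi_k}\eta_{k+1},\qquad\delta a_k=-(\eta_k)_M(a_k),$$ where $\eta_d=(\eta_k)_{0\le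 k\le N}$ is any discrete curve in $\mathfrak{g}$ with vanishing endpoints. (4) The discrete curve $(\Xi_d,a_d,S_d)$ is a solution of the discrete Euler–Poincaré equations for simple thermodynamical systems $$D_1\mathsf{L}_d(\Xi_k,a_k,S_k,S_{k+1})\,T_eR_{\Xi_k}=D_1\mathsf{L}_d(\Xi_{k-1},a_{k-1},S_{k-1},S_k)\,T_eL_{\Xi_{k-1}}-\mathbf{J}\big(D_2\mathsf{L}_d(\Xi_k,a_k,S_k,S_{k+1})\big)$$ $$+(\mathsf{F}^{{\rm ext}-}_d+\mathsf{F}^{{\rm fr}-}_d)(\Xi_k,a_k,S_k,S_{k+1})+(\mathsf{F}^{{\rm ext}+}_d+\mathsf{F}^{{\rm fr}+}_d)(\Xi_{k-1},a_{k-1},S_{k-1},S_k)\quad\text{for } k\in\{1,\dots,N-1\},$$ $$\mathsf{P}_d(\Xi_k,a_k,S_k,S_{k+1})=0,\qquad a_{k+1}=\Xi_k^{-1}a_k\quad\text{for } k\in\{0,\dots,N-1\}.$$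
   Context: All maps are smooth. $G_{a_{\rm ref}}\subset G$ is the isotropy subgroup of $a_{\rm ref}$ and $\operatorname{Orb}(a_{\rm ref})\subset M$ its $G$-orbit; actions are written by concatenation. $L_g,R_g$ denote left and right multiplication by $g$ in $G$. For $\eta\in\mathfrak{g}$, $\eta_M(x)=\frac{d}{ds}\big|_{s=0}\exp(s\eta)x$ is the infinitesimal generator on $M$. $D_i$ denotes the partial derivative with respect to the $i$-th argument. $\mathbf{J}:T^*M\to\mathfrak{g}^*$ is the momentum map $\langle\mathbf{J}(\alpha_x),\eta\rangle=\langle\alpha_x,\eta_M(x)\rangle$; the same formula defines $\mathbf{J}(D_2\mathsf{L}_d)$ since $\eta_M(a)$ is tangent to $\operatorname{Orb}(a_{\rm ref})$. $D_1\mathsf{L}_d(\Xi,\dots)\,T_eR_\Xi\in\mathfrak{g}^*$ is the composition of $D_1\mathsf{L}_d(\Xi,\dots)\in T^*_\Xi G$ with $T_eR_\Xi:\mathfrak{g}\to T_\Xi G$, and similarly for $T_eL_\Xi$. A discrete curve $g_d$ is a sequence $(g_k)_{0\le k\le N}$, and its variations are sequences $\delta g_k\in T_{g_k}G$; $\delta S_k\in\mathbb{R}$ similarly. $\delta\sum$ is the derivative of the discrete action in the direction of the variation. In (3) it is computed with $\delta\Xi_k,\delta a_k,\delta S_k$ given by the stated constraints, and the condition is required for all such $\eta_d,\delta S_d$. Discrete forces are fiber-preserving: $F^-_d(g_0,g_1,S_0,S_1)\in T^*_{g_0}G$ and $F^+_d(g_0,g_1,S_0,S_1)\in T^*_{g_1}G$.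 The discrete phenomenological constraint is a real-valued function $P_{d,a_{\rm ref}}$ on $G\times G\times\mathbb{R}\times\mathbb{R}$; it arises as $P\circ\varphi$, where $\varphi:G\times G\times\mathbb{R}\times\mathbb{R}\to TG\times T\mathbb{R}$ is a finite difference map (discretizing $g,\dot g,S,\dot S$) and $P=\frac{\partial L}{\partial S}\dot S-\langle F^{\rm fr},\dot g\rangle+P^{\rm ext}_H$ is the continuous phenomenological constraint function; in the statement it enters only as a $G_{a_{\rm ref}}$-invariant function. A map $\Phi_d:G\times G\times\mathbb{R}\times\mathbb{R}\to\mathbb{R}$ is $G_{a_{\rm ref}}$-invariant if $\Phi_d(gh_0,gh_1,S_0,S_1)=\Phi_d(h_0,h_1,S_0,S_1)$ for all $g\in G_{a_{\rm ref}}$, $h_0,h_1\in G$, $S_0,S_1\in\mathbb{R}$; its reduced map is defined by $\varphi_d(g_0^{-1}g_1,g_0^{-1}a_{\rm ref},S_0,S_1)=\Phi_d(g_0,g_1,S_0,S_1)$. A pair of discrete forces $F_d^\pm$ is $G_{a_{\rm ref}}$-equivariant if $F_d^\pm(gh_0,gh_1,S_0,S_1)=g\,F_d^\pm(h_0,h_1,S_0,S_1)$ for all $g\in G_{a_{\rm ref}}$ (cotangent lift of $L_g$); the reduced forces are defined by $\mathsf{F}^+_d(g_0^{-1}g_1,g_0^{-1}a_{\rm ref},S_0,S_1)=g_1^{-1}F^+_d(g_0,g_1,S_0,S_1)$ and $\mathsf{F}^-_d(g_0^{-1}g_1,g_0^{-1}a_{\rm ref},S_0,S_1)=g_0^{-1}F^-_d(g_0,g_1,S_0,S_1)$,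 where $\langle g^{-1}\alpha_g,\eta\rangle=\langle\alpha_g,T_eL_g\eta\rangle$ for $\alpha_g\in T^*_gG$.
   Formalization: The full equivalence of (1)–(4) is stated assuming that for every δg_d vanishing at the endpoints some δS_d satisfies the discrete variational constraint (else (1)⇒(2) can fail, e.g. L_d=0 with friction); (1)⇔(3), (2)⇔(4), (2)⇒(1) need no such assumption. *)

(* Defs.v *)
From HB Require Import structures.
From mathcomp Require Import all_boot all_order all_algebra.
From mathcomp Require Import all_classical all_reals all_analysis.
Set Implicit Arguments.
Unset Strict Implicit.
Unset Printing Implicit Defensive.
Import Order.TTheory GRing.Theory Num.Theory.
Import numFieldNormedType.Exports.
Local Open Scope classical_set_scope.
Local Open Scope ring_scope.

(* C^n regularity on an open set of a finite-dimensional space, by induction on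
   the directional derivatives. *)
Fixpoint Cn_on (R : realType) (V W : normedModType R) (n : nat) (U : set V)
    (f : V -> W) : Prop :=
  if n is m.+1 then
    (forall x, U x -> differentiable f x) /\
    forall v, Cn_on m U (fun x => 'D_v f x)
  else forall x, U x -> {for x, continuous f}.

Definition Cinfty_on (R : realType) (V W : normedModType R) (U : set V)
  (f : V -> W) : Prop := forall n, Cn_on n U f.

Definition finite_dimensional (R : realType) (V : normedModType R) : Prop :=
  exists (n : nat) (b : 'I_n -> V), forall v, exists c : 'I_n -> R,
    v = \sum_i c i *: b i.

(* [bwd] is only meaningful on the open set [fwd @` dom]. *)
Record chart (R : realType) (T : topologicalType) (V : normedModType R) :=
  Chart {
  dom : set T;
  fwd : T -> V;
  bwd : V -> T;
  dom_open : open dom;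
  cod_open : open (fwd @` dom);
  fwdK : forall x, dom x -> bwd (fwd x) = x;
  fwd_continuous : forall x, dom x -> {for x, continuous fwd};
  bwd_continuous : forall y, (fwd @` dom) y -> {for y, continuous bwd}
}.

(* Finite-dimensional, Hausdorff, second countable. [chart_at x] is a fixed
   choice of an atlas chart around [x]. *)
HB.mixin Record isManifold (R : realType) T of Topological T := {
  model : normedModType R;
  atlas : set (chart T model);
  chart_at : T -> chart T model;
  model_finite : finite_dimensional model;
  chart_at_atlas : forall x, atlas (chart_at x);
  chart_at_dom : forall x, dom (chart_at x) x;
  atlas_compatible : forall phi psi, atlas phi -> atlas psi ->
    Cinfty_on (fwd phi @` (dom phi `&` dom psi)) (fwd psi \o bwd phi);
  manifold_hausdorff : hausdorff_space T;
  manifold_second_countable : @second_countable T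
}.

#[short(type="manifoldType")]
HB.structure Definition Manifold (R : realType) :=
  {T of isManifold R T & Topological T}.

Arguments model {R} s.

Section CnTheory.
Context (R : realType).

Lemma near_eq_differentiable (V W : normedModType R) (f g : V -> W) (x : V) :
  {near x, f =1 g} -> differentiable f x -> differentiable g x.
Proof.
move=> fg df.
have -> : g = f + (g - f) by rewrite addrC subrK.
apply: differentiableD => //.
have gf0 : (g - f) \o shift x = cst ((g - f) x) + (\0 : {linear V -> W}) +o_ 0 id.
  apply/eqaddoP => _/posnumP[e].
  have : \forall h \near (0 : V), f (h + x) = g (h + x).
    have := fg; rewrite /= (near_shift 0 x).
    by apply: filterS => h /=; rewrite subr0.
  apply: filterS => h fh /=.
  have fxx : f x = g x by exact: nbhs_singleton fg.
  rewrite !fctE /= /shift /= fh fxx !subrr addr0 subr0 normr0; exact: mulr_ge0.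
have c0 : continuous (\0 : V -> W) by exact: cst_continuous.
have dE := @diff_unique _ _ _ _ (\0 : {linear V -> W}) _ c0 gf0.
apply/(proj2 (@diff_locallyP _ _ _ _ _)); split; rewrite dE => //.
Qed.

Lemma eq_Cn_on (V W : normedModType R) n (U : set V) (f g : V -> W) :
  open U -> (forall x, U x -> f x = g x) -> Cn_on n U f -> Cn_on n U g.
Proof.
move=> oU; elim: n f g => [|n IHn] f g fg /=.
  move=> cf x Ux; have nfg : {near x, f =1 g}.
    by apply: filterS (open_nbhs_nbhs (conj oU Ux)) => y /fg.
  rewrite /prop_for /continuous_at -(fg x Ux).
  by apply: cvg_trans (cf x Ux); exact: near_eq_cvg.
move=> [df Df]; split.
  move=> x Ux; apply: near_eq_differentiable (df x Ux).
  by apply: filterS (open_nbhs_nbhs (conj oU Ux)) => y /fg.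
move=> v; apply: (IHn _ _ _ (Df v)) => x Ux.
apply: near_eq_derive.
by apply: filterS (open_nbhs_nbhs (conj oU Ux)) => y /fg.
Qed.

Lemma open_prod (T1 T2 : topologicalType) (A : set T1) (B : set T2) :
  open A -> open B -> open (A `*` B).
Proof.
rewrite !openE => oA oB [x y] /= [/oA Ax /oB By].
by exists (A, B) => //; split.
Qed.


Lemma Cn_on_prod (V1 W1 V2 W2 : normedModType R) n (U1 : set V1) (U2 : set V2)
    (f1 : V1 -> W1) (f2 : V2 -> W2) :
  open U1 -> open U2 -> Cn_on n U1 f1 -> Cn_on n U2 f2 ->
  Cn_on n (U1 `*` U2) (fun p : V1 * V2 => (f1 p.1, f2 p.2)).
Proof.
move=> o1 o2; elim: n f1 f2 => [|n IHn] f1 f2 /=.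
  move=> c1 c2 [x y] /= [Ux Uy]; apply: cvg_pair => /=.
    by have h := c1 _ Ux; apply: (cvg_comp fst f1 _ h); exact: cvg_fst.
  by have h := c2 _ Uy; apply: (cvg_comp snd f2 _ h); exact: cvg_snd.
move=> [d1 D1] [d2 D2].
have dp (p : V1 * V2) : (U1 `*` U2) p ->
    is_diff p (fun p : V1 * V2 => (f1 p.1, f2 p.2))
      (fun v : V1 * V2 => ('d f1 (p.1) (v.1) : W1, 'd f2 (p.2) (v.2) : W2)).
  move=> [/= Ux Uy].
  have h1 : is_diff (p.1) f1 ('d f1 (p.1)) by apply: DiffDef => //; exact: d1.
  have h2 : is_diff (p.2) f2 ('d f2 (p.2)) by apply: DiffDef => //; exact: d2.
  have hf : is_diff p (fst : V1 * V2 -> V1) fst.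
    apply: DiffDef; first by apply: linear_differentiable => ?; exact: cvg_fst.
    by apply: diff_lin => ?; exact: cvg_fst.
  have hs : is_diff p (snd : V1 * V2 -> V2) snd.
    apply: DiffDef; first by apply: linear_differentiable => ?; exact: cvg_snd.
    by apply: diff_lin => ?; exact: cvg_snd.
  exact: is_diff_pair (is_diff_comp hf h1) (is_diff_comp hs h2).
split=> [p /dp []//|v].
apply: (eq_Cn_on (open_prod o1 o2) _ (IHn _ _ (D1 v.1) (D2 v.2))) => p Up.
have [dfp E] := dp p Up; case: Up => /= Ux Uy.
by rewrite [RHS]deriveE// E /= !deriveE//; [exact: d2|exact: d1].
Qed.

Lemma hausdorff_prod (T1 T2 : topologicalType) :
  hausdorff_space T1 -> hausdorff_space T2 -> hausdorff_space (T1 * T2)%type.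
Proof.
move=> h1 h2 [p1 p2] [q1 q2] pq; congr pair.
  apply: h1 => A B Ap Bq.
  have [ | | [x y] /= [[Ax _] [Bx _]]] := pq (A `*` setT) (B `*` setT).
  - by exists (A, setT) => //; split => //; exact: filterT.
  - by exists (B, setT) => //; split => //; exact: filterT.
  by exists x.
apply: h2 => A B Ap Bq.
have [ | | [x y] /= [[_ Ax] [_ Bx]]] := pq (setT `*` A) (setT `*` B).
- by exists (setT, A) => //; split => //; exact: filterT.
- by exists (setT, B) => //; split => //; exact: filterT.
by exists y.
Qed.

Lemma second_countable_prod (T1 T2 : topologicalType) :
  @second_countable T1 -> @second_countable T2 ->
  @second_countable (T1 * T2)%type.
Proof.
move=> [B1 c1 [hB1 b1]] [B2 c2 [hB2 b2]].
exists ((fun p => p.1 `*` p.2) @` (B1 `*` B2)).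
  by apply: card_le_trans (card_image_le _ _) _; exact: countableX.
split=> [_ [[A1 A2] [/= /hB1 ? /hB2 ?] <-]|[x y] A]; first exact: open_prod.
move=> [[A1 A2] /= [/(b1 x)[U1 [BU1 Ux] UA1] /(b2 y)[U2 [BU2 Uy] UA2]] AA].
exists (U1 `*` U2); first by split=> //; exists (U1, U2).
by move=> [u v] [/= /UA1 ? /UA2 ?]; exact: AA.
Qed.

Lemma second_countable_real : @second_countable R.
Proof.
pose I (p : rat * rat) : set R := `]ratr p.1, ratr p.2[%classic.
exists (I @` setT).
  by apply: card_le_trans (card_image_le _ _) _; exact: countableP.
split=> [_ [p _ <-]|x A /nbhs_ballP[_/posnumP[e] xA]].
  exact: interval_open.
have [p /itvP pI] : exists q, ratr q \in `]x - e%:num, x[.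
  by apply: rat_in_itvoo; rewrite ltrBlDr ltrDl.
have [q /itvP qI] : exists q, ratr q \in `]x, x + e%:num[.
  by apply: rat_in_itvoo; rewrite ltrDl.
exists (I (p, q)); first by split; [exists (p, q)|rewrite /I/= in_itv/= pI qI].
move=> y; rewrite /I/= in_itv/= => /andP[py yq]; apply: xA.
rewrite /ball/= distrC ltr_distl (lt_trans _ py) ?pI//=.
by rewrite (lt_le_trans yq)// ltW// qI.
Qed.

Lemma finite_dimensional_prod (V1 V2 : normedModType R) :
  finite_dimensional V1 -> finite_dimensional V2 ->
  finite_dimensional (V1 * V2)%type.
Proof.
move=> [n1 [b1 H1]] [n2 [b2 H2]].
exists (n1 + n2)%N, (fun i => match fintype.split i with
  | inl i => (b1 i, 0) | inr i => (0, b2 i) end) => -[v1 v2].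
have [c1 E1] := H1 v1; have [c2 E2] := H2 v2.
exists (fun i => match fintype.split i with inl i => c1 i | inr i => c2 i end).
rewrite big_split_ord/=.
under eq_bigr do rewrite (unsplitK (inl _)).
under [X in _ + X]eq_bigr do rewrite (unsplitK (inr _)).
rewrite E1 E2.
have HE : forall (n : nat) (w : 'I_n -> V1 * V2),
    \sum_i w i = (\sum_i (w i).1, \sum_i (w i).2).
  move=> n w; rewrite (@surjective_pairing _ _ (\sum_i w i)).
  by rewrite (raddf_sum (fst : V1 * V2 -> V1)) (raddf_sum (snd : V1 * V2 -> V2)).
rewrite !HE /=.
under [X in (_, X) + _]eq_bigr do rewrite scaler0.
under [X in _ + (X, _)]eq_bigr do rewrite scaler0.
by rewrite !big1_eq; congr pair; rewrite ?addr0 ?add0r.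
Qed.

Lemma Cinfty_on_id (V : normedModType R) (U : set V) : Cinfty_on U id.
Proof.
case=> [|n] /=; first by move=> x _; exact: cvg_id.
split=> [x _|v]; first exact: ex_diff.
have -> : (fun x => 'D_v id x) = cst v :> (V -> V).
  by apply/funext => x; rewrite derive_id.
elim: n v => [|n IHn] v /=; first by move=> x _; exact: cst_continuous.
split=> [x _|w]; first exact: differentiable_cst.
have -> : (fun x => 'D_w (cst v) x) = cst 0 :> (V -> V).
  by apply/funext => x; rewrite derive_cst.
exact: IHn.
Qed.

End CnTheory.

Section RealManifold.
Context (R : realType).

Definition real_chart : chart R R^o.
Proof.
refine (@Chart R R R^o setT id id openT _ _ _ _).
- by rewrite image_id; exact: openT.
- by [].
- by move=> x _; exact: cvg_id.
- by move=> x _; exact: cvg_id.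
Defined.

Lemma real_finite : finite_dimensional R^o.
Proof.
exists 1%N, (fun=> 1) => v; exists (fun=> v).
by rewrite big_ord1 /GRing.scale/= mulr1.
Qed.

Lemma real_atlas_compatible (phi psi : chart R R^o) :
  [set real_chart] phi -> [set real_chart] psi ->
  Cinfty_on (fwd phi @` (dom phi `&` dom psi)) (fwd psi \o bwd phi).
Proof. by move=> -> ->; exact: Cinfty_on_id. Qed.

HB.instance Definition _ := @isManifold.Build R R^o R^o [set real_chart]
  (fun=> real_chart) real_finite (fun=> erefl) (fun=> I)
  real_atlas_compatible (@Rhausdorff R) (@second_countable_real R).

End RealManifold.

Section ProdManifold.
Context (R : realType).

Section ProdChart.
Context (T1 T2 : topologicalType) (V1 V2 : normedModType R).
Context (phi : chart T1 V1) (psi : chart T2 V2).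

Let pfwd (p : T1 * T2) : V1 * V2 := (fwd phi p.1, fwd psi p.2).
Let pbwd (q : V1 * V2) : T1 * T2 := (bwd phi q.1, bwd psi q.2).

Lemma prod_cod :
  pfwd @` (dom phi `*` dom psi) = (fwd phi @` dom phi) `*` (fwd psi @` dom psi).
Proof.
apply/seteqP; split => [_ [[x y] /= [Dx Dy] <-]|[u v] /= [[x Dx <-] [y Dy <-]]].
  by split; [exists x|exists y].
by exists (x, y).
Qed.

Lemma prod_fwdK p : (dom phi `*` dom psi) p -> pbwd (pfwd p) = p.
Proof. by case: p => x y [/= Dx Dy]; rewrite /pbwd/= !fwdK. Qed.

Lemma prod_fwd_continuous p :
  (dom phi `*` dom psi) p -> {for p, continuous pfwd}.
Proof.
case: p => x y [/= Dx Dy]; apply: cvg_pair => /=.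
  have h := fwd_continuous Dx.
  by apply: (cvg_comp fst (fwd phi) _ h); exact: cvg_fst.
have h := fwd_continuous Dy.
by apply: (cvg_comp snd (fwd psi) _ h); exact: cvg_snd.
Qed.

Lemma prod_bwd_continuous q :
  (pfwd @` (dom phi `*` dom psi)) q -> {for q, continuous pbwd}.
Proof.
rewrite prod_cod; case: q => u v [/= Cu Cv]; apply: cvg_pair => /=.
  have h := bwd_continuous Cu.
  by apply: (cvg_comp fst (bwd phi) _ h); exact: cvg_fst.
have h := bwd_continuous Cv.
by apply: (cvg_comp snd (bwd psi) _ h); exact: cvg_snd.
Qed.

Lemma prod_cod_open : open (pfwd @` (dom phi `*` dom psi)).
Proof. by rewrite prod_cod; apply: open_prod; exact: cod_open. Qed.

Definition prod_chart : chart (T1 * T2)%type (V1 * V2)%type :=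
  Chart (open_prod (dom_open phi) (dom_open psi)) prod_cod_open
    prod_fwdK prod_fwd_continuous prod_bwd_continuous.

End ProdChart.

Context (M N : manifoldType R).

Definition prod_atlas : set (chart (M * N)%type (model M * model N)%type) :=
  [set chi | exists phi psi, [/\ atlas phi, atlas psi &
     chi = prod_chart phi psi]].

Lemma prod_chart_at_atlas (p : M * N) :
  prod_atlas (prod_chart (chart_at p.1) (chart_at p.2)).
Proof.
by exists (chart_at p.1), (chart_at p.2); split=> //; exact: chart_at_atlas.
Qed.

Lemma prod_chart_at_dom (p : M * N) :
  dom (prod_chart (chart_at p.1) (chart_at p.2)) p.
Proof. by split; exact: chart_at_dom. Qed.

Lemma open_fwd_dom (T : topologicalType) (V : normedModType R) (c e : chart T V) :
  open (fwd c @` (dom c `&` dom e)).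
Proof.
rewrite openE => _ [x [cx ex] <-].
have hc : nbhs (fwd c x) (fwd c @` dom c).
  by apply: open_nbhs_nbhs; split; [exact: cod_open|exists x].
have he : nbhs (fwd c x) (bwd c @^-1` dom e).
  apply: (bwd_continuous (c := c)); first by exists x.
  by rewrite fwdK//; apply: open_nbhs_nbhs; split => //; exact: dom_open.
apply: filterS (filterI hc he) => _ [[z cz <-]] /=; rewrite fwdK// => ez.
by exists z.
Qed.

Lemma prod_atlas_compatible (c e : chart (M * N)%type (model M * model N)%type) :
  prod_atlas c -> prod_atlas e ->
  Cinfty_on (fwd c @` (dom c `&` dom e)) (fwd e \o bwd c).
Proof.
move=> [c1 [c2 [a1 a2 ->]]] [e1 [e2 [b1 b2 ->]]] n.
have -> : fwd (prod_chart c1 c2) @`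
      (dom (prod_chart c1 c2) `&` dom (prod_chart e1 e2)) =
    (fwd c1 @` (dom c1 `&` dom e1)) `*` (fwd c2 @` (dom c2 `&` dom e2)).
  apply/seteqP; split => [_ [[x y] /= [[/= ? ?] [/= ? ?]] <-]|].
    by split; [exists x|exists y].
  move=> [u v] [/= [x [? ?] <-] [y [? ?] <-]].
  by exists (x, y).
have h := Cn_on_prod (open_fwd_dom c1 e1) (open_fwd_dom c2 e2)
  (atlas_compatible _ _ a1 b1 n) (atlas_compatible _ _ a2 b2 n).
exact h.
Qed.

HB.instance Definition _ := @isManifold.Build R (M * N)%type
  (model M * model N)%type prod_atlas
  (fun p => prod_chart (chart_at p.1) (chart_at p.2))
  (finite_dimensional_prod (@model_finite R M) (@model_finite R N))
  prod_chart_at_atlas prod_chart_at_dom prod_atlas_compatible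
  (hausdorff_prod (@manifold_hausdorff R M) (@manifold_hausdorff R N))
  (second_countable_prod (@manifold_second_countable R M)
     (@manifold_second_countable R N)).

End ProdManifold.

Section Calculus.
Context (R : realType).

(* Only meaningful for [U] open. *)
Definition smooth_on (M N : manifoldType R) (U : set M) (f : M -> N) : Prop :=
  (forall x, U x -> {for x, continuous f}) /\
  forall (phi : chart M (model M)) (psi : chart N (model N)),
    atlas phi -> atlas psi ->
    Cinfty_on (fwd phi @` (dom phi `&` U `&` f @^-1` dom psi))
              (fwd psi \o f \o bwd phi).

Definition smooth (M N : manifoldType R) (f : M -> N) : Prop :=
  smooth_on setT f.

(* A tangent vector at [x] is represented by its coordinates in the chart
   [chart_at x]; the representation, not the type, depends on [x]. *)
Definition tangent (M : manifoldType R) (x : M) : normedModType R := model M.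

Definition cotangent (M : manifoldType R) (x : M) := {linear tangent x -> R^o}.

Definition Tmap (M N : manifoldType R) (f : M -> N) (x : M) :
    {linear tangent x -> tangent (f x)} :=
  'd (fwd (chart_at (f x)) \o f \o bwd (chart_at x)) (fwd (chart_at x) x).

Definition differential (M : manifoldType R) (f : M -> R) (x : M) :
  cotangent x := Tmap (f : M -> R^o) x.

Definition velocity (M : manifoldType R) (c : R -> M) (t : R) :
  tangent (c t) := Tmap (c : R^o -> M) t 1.

(* A curve through [x] with velocity [v] at time 0. *)
Definition curve_through (M : manifoldType R) (x : M) (v : tangent x) (e : R) :
  M := bwd (chart_at x) (fwd (chart_at x) x + e *: v).

(* The vector at [x] whose coordinates in the chart [phi] are [v]. *)
Definition coord_vector (M : manifoldType R) (phi : chart M (model M))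
    (v : model M) (x : M) : tangent x :=
  'd (fwd (chart_at x) \o bwd phi) (fwd phi x) v.

(* Smoothness of a map [N -> T^*M] over the base map [b]: the coefficients in
   the charts of [M] are smooth. *)
Definition smooth_covector (N M : manifoldType R) (b : N -> M)
    (alpha : forall n, cotangent (b n)) : Prop :=
  forall phi : chart M (model M), atlas phi -> forall v : model M,
    smooth_on (b @^-1` dom phi)
      (fun n => alpha n (coord_vector phi v (b n)) : R^o).

End Calculus.

HB.mixin Record Manifold_isLieGroup (R : realType) G
    of Manifold R G & Group G := {
  mulg_smooth : smooth (fun p : G * G => (p.1 * p.2)%g);
  invg_smooth : smooth (fun g : G => (g^-1)%g)
}.

#[short(type="lieGroupType")]
HB.structure Definition LieGroup (R : realType) :=
  {G of Manifold_isLieGroup R G & Manifold R G & Group G}.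

Section LieGroups.
Context (R : realType) (G : lieGroupType R).

Definition lie_algebra := tangent (1%g : G).
Definition lie_dual := cotangent (1%g : G).

Definition TeL (g : G) (eta : lie_algebra) : tangent g :=
  Tmap (fun h : G => (g * h)%g) 1%g eta.
Definition TeR (g : G) (eta : lie_algebra) : tangent g :=
  Tmap (fun h : G => (h * g)%g) 1%g eta.

(* The exponential map is the unique map satisfying this: [s |-> expG (s eta)] is
   the one-parameter subgroup with velocity [eta] at 0. *)
Definition is_exponential (expG : lie_algebra -> G) : Prop :=
  forall eta : lie_algebra,
    [/\ smooth (fun s : R^o => expG (s *: eta)),
        forall s t : R,
          expG ((s + t) *: eta) = (expG (s *: eta) * expG (t *: eta))%g &
        velocity (fun s : R => expG (s *: eta)) 0 = eta].

Record smooth_action (M : manifoldType R) := SmoothAction {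
  act :> G -> M -> M;
  act1 : forall x, act 1%g x = x;
  actM : forall g h x, act (g * h)%g x = act g (act h x);
  act_smooth : smooth (fun p : G * M => act p.1 p.2)
}.

Definition isotropy (M : manifoldType R) (to : smooth_action M) (x : M) :
  set G := [set g | to g x = x].

Definition orbit (M : manifoldType R) (to : smooth_action M) (x : M) :
  set M := [set to g x | g in setT].

(* [exp (0 * eta)] acts trivially, so this is a tangent vector at [x]. *)
Definition inf_generator (M : manifoldType R) (expG : lie_algebra -> G)
    (to : smooth_action M) (eta : lie_algebra) (x : M) : tangent x :=
  velocity (fun s : R => to (expG (s *: eta)) x) 0.

(* The orbit with its structure of immersed submanifold: a manifold with a
   smooth action, injectively immersed in [M] by an equivariant map onto the
   orbit. These data are unique up to a unique diffeomorphism (they are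
   G / G_x). *)
Record orbit_manifold (M : manifoldType R) (to : smooth_action M) (x : M) :=
  OrbitManifold {
  orb_car :> manifoldType R;
  orb_act : smooth_action orb_car;
  orb_incl : orb_car -> M;
  orb_base : orb_car;
  orb_incl_smooth : smooth orb_incl;
  orb_incl_inj : injective orb_incl;
  orb_incl_immersion : forall o, injective (Tmap orb_incl o);
  orb_incl_range : range orb_incl = orbit to x;
  orb_incl_equivariant : forall g o, orb_incl (orb_act g o) = to g (orb_incl o);
  orb_incl_base : orb_incl orb_base = x
}.

(* Used below on the orbit: as [orb_incl] is equivariant, its tangent map sends
   [inf_generator expG (orb_act O) eta o], which is thus eta_M seen as a vector
   tangent to the orbit, to [inf_generator expG to eta (orb_incl o)]. *)
Definition J (M : manifoldType R) (expG : lie_algebra -> G)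
    (to : smooth_action M) (x : M) (alpha : cotangent x) (eta : lie_algebra) :
  R := alpha (inf_generator expG to eta x).

Definition smooth4 (A B : manifoldType R) (Phi : A -> B -> R -> R -> R) : Prop :=
  smooth (fun p : A * B * R^o * R^o => Phi p.1.1.1 p.1.1.2 p.1.2 p.2 : R^o).

Section Partials.
Context (A B : manifoldType R) (Phi : A -> B -> R -> R -> R).

Definition D1 (x : A) (y : B) (s t : R) : cotangent x :=
  differential (fun x' => Phi x' y s t) x.
Definition D2 (x : A) (y : B) (s t : R) : cotangent y :=
  differential (fun y' => Phi x y' s t) y.
Definition D3 (x : A) (y : B) (s t : R) : R := derive1 (fun s' => Phi x y s' t) s.
Definition D4 (x : A) (y : B) (s t : R) : R := derive1 (fun t' => Phi x y s t') t.

End Partials.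

(* Fiber-preserving maps [G * G * R * R -> T^*G], over the first and over the
   second projection respectively. *)
Record discrete_force := DiscreteForce {
  fminus : forall g0 g1 : G, R -> R -> cotangent g0;
  fplus : forall g0 g1 : G, R -> R -> cotangent g1;
  fminus_smooth : @smooth_covector R (G * G * R^o * R^o)%type G
    (fun p => p.1.1.1) (fun p => fminus p.1.1.1 p.1.1.2 p.1.2 p.2);
  fplus_smooth : @smooth_covector R (G * G * R^o * R^o)%type G
    (fun p => p.1.1.2) (fun p => fplus p.1.1.1 p.1.1.2 p.1.2 p.2)
}.

Record reduced_force (O : manifoldType R) := ReducedForce {
  rminus : G -> O -> R -> R -> lie_dual;
  rplus : G -> O -> R -> R -> lie_dual;
  rminus_smooth : forall eta : lie_algebra,
    smooth4 (fun Xi a s t => rminus Xi a s t eta : R^o);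
  rplus_smooth : forall eta : lie_algebra,
    smooth4 (fun Xi a s t => rplus Xi a s t eta : R^o)
}.

Section Reduction.
Context (M : manifoldType R) (to : smooth_action M) (aref : M).

Definition isotropy_invariant (Phi : G -> G -> R -> R -> R) : Prop :=
  forall g, isotropy to aref g -> forall h0 h1 S0 S1,
    Phi (g * h0)%g (g * h1)%g S0 S1 = Phi h0 h1 S0 S1.

(* The cotangent lift of [L_g] is [alpha |-> alpha \o T L_(g^-1)]. *)
Definition isotropy_equivariant (F : discrete_force) : Prop :=
  forall g, isotropy to aref g -> forall h0 h1 S0 S1,
    (forall v : tangent (g * h0)%g,
       fminus F (g * h0)%g (g * h1)%g S0 S1 v =
       fminus F h0 h1 S0 S1 (Tmap (fun h : G => (g^-1 * h)%g) (g * h0)%g v)) /\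
    (forall v : tangent (g * h1)%g,
       fplus F (g * h0)%g (g * h1)%g S0 S1 v =
       fplus F h0 h1 S0 S1 (Tmap (fun h : G => (g^-1 * h)%g) (g * h1)%g v)).

Context (O : orbit_manifold to aref).

(* The point of the orbit included in [M] as g^-1 a_ref. *)
Definition orb_pt (g : G) : O := orb_act O (g^-1)%g (orb_base O).

Definition is_reduced_map (Phi : G -> G -> R -> R -> R)
    (phi : G -> O -> R -> R -> R) : Prop :=
  smooth4 phi /\
  forall g0 g1 S0 S1,
    phi (g0^-1 * g1)%g (orb_pt g0) S0 S1 = Phi g0 g1 S0 S1.

Definition is_reduced_force (F : discrete_force) (f : reduced_force O) : Prop :=
  forall g0 g1 S0 S1 (eta : lie_algebra),
    rminus f (g0^-1 * g1)%g (orb_pt g0) S0 S1 eta =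
      fminus F g0 g1 S0 S1 (TeL g0 eta) /\
    rplus f (g0^-1 * g1)%g (orb_pt g0) S0 S1 eta =
      fplus F g0 g1 S0 S1 (TeL g1 eta).

End Reduction.

(* Only the values of the sequences at indices at most [N] matter below. *)
Section Unreduced.
Context (N : nat) (L P : G -> G -> R -> R -> R) (Fext Ffr : discrete_force).
Context (g : nat -> G) (S : nat -> R).

Definition phenomenological : Prop :=
  forall k, (k < N)%N -> P (g k) (g k.+1) (S k) (S k.+1) = 0.

Definition variational_constraint (dg : forall k, tangent (g k))
    (dS : nat -> R) : Prop :=
  forall k, (k < N)%N ->
    D3 L (g k) (g k.+1) (S k) (S k.+1) * dS k +
    D4 L (g k) (g k.+1) (S k) (S k.+1) * dS k.+1 =
    fminus Ffr (g k) (g k.+1) (S k) (S k.+1) (dg k) +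
    fplus Ffr (g k) (g k.+1) (S k) (S k.+1) (dg k.+1).

(* Derivative of the discrete action in the direction [(dg, dS)]. *)
Definition delta_action (dg : forall k, tangent (g k)) (dS : nat -> R) : R :=
  derive1 (fun e : R => \sum_(0 <= k < N)
     L (curve_through (dg k) e) (curve_through (dg k.+1) e)
       (S k + e * dS k) (S k.+1 + e * dS k.+1)) 0.

Definition critical : Prop :=
  (forall (dg : forall k, tangent (g k)) (dS : nat -> R),
     dg 0%N = 0 -> dg N = 0 -> variational_constraint dg dS ->
     delta_action dg dS +
     \sum_(0 <= k < N)
       (fminus Fext (g k) (g k.+1) (S k) (S k.+1) (dg k) +
        fplus Fext (g k) (g k.+1) (S k) (S k.+1) (dg k.+1)) = 0) /\
  phenomenological.

Definition discrete_equations : Prop :=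
  (forall k, (0 < k < N)%N -> forall v : tangent (g k),
     D1 L (g k) (g k.+1) (S k) (S k.+1) v +
     D2 L (g k.-1) (g k) (S k.-1) (S k) v +
     (fminus Fext (g k) (g k.+1) (S k) (S k.+1) v +
      fminus Ffr (g k) (g k.+1) (S k) (S k.+1) v) +
     (fplus Fext (g k.-1) (g k) (S k.-1) (S k) v +
      fplus Ffr (g k.-1) (g k) (S k.-1) (S k) v) = 0) /\
  phenomenological.

(* Every variation of [g] with fixed endpoints is admissible, i.e. the
   variational constraint can be solved for the variation of [S]. This holds
   for instance if [D4 L] never vanishes along the curve, or if [D3 L] never
   vanishes along it. *)
Definition variations_admissible : Prop :=
  forall dg : forall k, tangent (g k), dg 0%N = 0 -> dg N = 0 ->
  exists dS : nat -> R, variational_constraint dg dS.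

End Unreduced.

Section Reduced.
Context (expG : lie_algebra -> G).
Context (M : manifoldType R) (to : smooth_action M) (aref : M).
Context (O : orbit_manifold to aref) (N : nat).
Context (l p : G -> O -> R -> R -> R) (fext ffr : reduced_force O).
Context (Xi : nat -> G) (a : nat -> O) (S : nat -> R).

Definition reduced_phenomenological : Prop :=
  forall k, (k < N)%N -> p (Xi k) (a k) (S k) (S k.+1) = 0.

Definition reduced_variational_constraint (eta : nat -> lie_algebra)
    (dS : nat -> R) : Prop :=
  forall k, (k < N)%N ->
    D3 l (Xi k) (a k) (S k) (S k.+1) * dS k +
    D4 l (Xi k) (a k) (S k) (S k.+1) * dS k.+1 =
    rminus ffr (Xi k) (a k) (S k) (S k.+1) (eta k) +
    rplus ffr (Xi k) (a k) (S k) (S k.+1) (eta k.+1).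

Definition reduced_delta_action (dXi : forall k, tangent (Xi k))
    (da : forall k, tangent (a k)) (dS : nat -> R) : R :=
  derive1 (fun e : R => \sum_(0 <= k < N)
     l (curve_through (dXi k) e) (curve_through (da k) e)
       (S k + e * dS k) (S k.+1 + e * dS k.+1)) 0.

Definition reduced_critical : Prop :=
  (forall (eta : nat -> lie_algebra) (dXi : forall k, tangent (Xi k))
      (da : forall k, tangent (a k)) (dS : nat -> R),
     eta 0%N = 0 -> eta N = 0 ->
     (forall k, (k < N)%N ->
        dXi k = - TeR (Xi k) (eta k) + TeL (Xi k) (eta k.+1) /\
        da k = - inf_generator expG (orb_act O) (eta k) (a k)) ->
     reduced_variational_constraint eta dS ->
     reduced_delta_action dXi da dS +
     \sum_(0 <= k < N)
       (rminus fext (Xi k) (a k) (S k) (S k.+1) (eta k) +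
        rplus fext (Xi k) (a k) (S k) (S k.+1) (eta k.+1)) = 0) /\
  reduced_phenomenological.

Definition discrete_euler_poincare : Prop :=
  [/\ forall k, (0 < k < N)%N -> forall eta : lie_algebra,
        D1 l (Xi k) (a k) (S k) (S k.+1) (TeR (Xi k) eta) =
        D1 l (Xi k.-1) (a k.-1) (S k.-1) (S k) (TeL (Xi k.-1) eta) -
        J expG (orb_act O) (D2 l (Xi k) (a k) (S k) (S k.+1)) eta +
        (rminus fext (Xi k) (a k) (S k) (S k.+1) eta +
         rminus ffr (Xi k) (a k) (S k) (S k.+1) eta) +
        (rplus fext (Xi k.-1) (a k.-1) (S k.-1) (S k) eta +
         rplus ffr (Xi k.-1) (a k.-1) (S k.-1) (S k) eta),
      reduced_phenomenological &
      forall k, (k < N)%N -> a k.+1 = orb_act O (Xi k)^-1%g (a k)].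

End Reduced.
End LieGroups.

(* Main.v *)
Require Import Defs.
From HB Require Import structures.
From mathcomp Require Import all_boot all_order all_algebra.
From mathcomp Require Import all_classical all_reals all_analysis.
From mathcomp Require Import ring.
Set Implicit Arguments.
Unset Strict Implicit.
Unset Printing Implicit Defensive.
Import Order.TTheory GRing.Theory Num.Theory.
Import numFieldNormedType.Exports.
Local Open Scope classical_set_scope.
Local Open Scope ring_scope.

(** Why the theorem is true.

    The variations with fixed endpoints and the variations of the reduced
    curve correspond to each other by left trivialization,
    [dg k = TeL (g k) (eta k)], and [TeL (g k)] is onto
    ([left_trivializationK]). Everything then follows from two computations.

    - Reduction of the derivatives. Along [c s = exp (s eta)],
      [Phi (g0 c) g1 = phi (c^-1 Xi) (c^-1 a)], and [c^-1] leaves [1] with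
      velocity [- eta]. Differentiating at [s = 0] yields ([D1_reduced])
        [D1 Phi (TeL g0 eta) = D1 phi (- TeR Xi eta) + D2 phi (- eta_O a)],
      while differentiating [Phi g0 (g1 h) = phi (Xi h) a] at [h = 1] yields
      ([D2_reduced])
        [D2 Phi (TeL g1 eta) = D1 phi (TeL Xi eta)].
      Added up, these say that the derivative of the action along [dg] is that
      of the reduced action along the Euler-Poincare variations of [Xi] and
      [a]; the constraints and the work of the forces agree by definition of
      the reduced forces. Hence (1) <-> (3). Substituted in the discrete
      equation at index [k], they turn it, evaluated on [TeL (g k) eta], into
      the discrete Euler-Poincare equation, evaluated on [eta]. Hence
      (2) <-> (4).

    - The first variation. The variational constraint trades the
      [D3 L dS + D4 L dS] part of the derivative of the action for the work of
      the friction forces. A summation by parts with fixed endpoints leaves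
      [sum_k force_balance k (dg k)], where [force_balance k] is the left-hand
      side of the discrete equation ([first_variation]). So (2) implies (1).
      Conversely, if every [dg] is admissible, a [dg] concentrated at the index
      [k] extracts the equation at [k] from (1).

    The calculus behind this is a chain rule on manifolds, for maps given with
    the coordinate expression of their tangent map at a point
    ([has_tangent_map]), and the total derivative of a smooth map of four
    arguments in terms of its partial derivatives
    ([has_tangent_map_chain]). *)

(** * Tangent maps in coordinates *)

Section TangentMaps.
Context (R : realType).

(** Differentials are local: coordinate expressions are only controlled near the
    point considered, where the charts are inverse bijections. *)
Lemma near_eq_is_diff (V W : normedModType R) (f f' : V -> W) (df : V -> W)
    (x : V) :
  {near x, f =1 f'} -> is_diff x f df -> is_diff x f' df.
Proof.
move=> ff' [df1 <-].
have df2 := near_eq_differentiable ff' df1.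
apply: DiffDef => //; apply/funext => v.
by rewrite -!deriveE//; apply/esym/near_eq_derive.
Qed.

(** [A] represents the tangent map of [f] at [x]. The value [y = f x] is a
    separate argument because the coordinates of a tangent vector are those of
    the chart fixed at its base point: points that are only provably equal,
    such as [1 * g] and [g], would otherwise give tangent maps expressed in
    charts that do not match syntactically. A curve through [x] with velocity
    [v] is the case [M = R], with [A = fun s => s *: v]. *)
Definition has_tangent_map (M N : manifoldType R) (f : M -> N) (x : M) (y : N)
    (A : model M -> model N) : Prop :=
  [/\ f x = y, {for x, continuous f} &
   is_diff (fwd (chart_at x) x) (fwd (chart_at y) \o f \o bwd (chart_at x)) A].

Section ChartAt.
Context (M : manifoldType R).

Lemma chart_at_nbhs (x : M) : nbhs x (dom (chart_at x)).
Proof.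
by apply: open_nbhs_nbhs; split; [exact: dom_open|exact: chart_at_dom].
Qed.

Lemma chart_at_cod_nbhs (x : M) :
  nbhs (fwd (chart_at x) x) (fwd (chart_at x) @` dom (chart_at x)).
Proof.
apply: open_nbhs_nbhs; split; first exact: cod_open.
by exists x => //; exact: chart_at_dom.
Qed.

Lemma bwd_chart_at_cvg (x : M) :
  bwd (chart_at x) y @[y --> fwd (chart_at x) x] --> x.
Proof.
have h := @bwd_continuous _ _ _ (chart_at x) (fwd (chart_at x) x).
rewrite /prop_for /continuous_at fwdK in h; last exact: chart_at_dom.
by apply: h; exists x => //; exact: chart_at_dom.
Qed.

End ChartAt.

Section Basic.
Context (M N : manifoldType R).

Lemma has_tangent_map_unique (f : M -> N) x y A B :
  has_tangent_map f x y A -> has_tangent_map f x y B -> A = B.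
Proof. by move=> [_ _ [_ <-]] [_ _ [_ <-]]. Qed.

Lemma has_tangent_map_Tmap (f : M -> N) x :
  smooth f -> has_tangent_map f x (f x) (Tmap f x).
Proof.
move=> [fc fd]; split=> //; first exact: fc.
apply: differentiableP.
have [] := fd _ _ (chart_at_atlas x) (chart_at_atlas (f x)) 1%N.
move=> + _; apply.
by exists x => //; split; [split=> //; exact: chart_at_dom|exact: chart_at_dom].
Qed.

Lemma TmapE (f : M -> N) x y A :
  has_tangent_map f x y A -> (Tmap f x : model M -> model N) = A.
Proof. by move=> [fxy _ [_ <-]]; rewrite /Tmap fxy. Qed.

Lemma has_tangent_map_cst (x : M) (y : N) :
  has_tangent_map (cst y : M -> N) x y (cst 0).
Proof.
split=> //; first exact: cst_continuous.
have h := is_diff_cst (fwd (chart_at y) y) (fwd (chart_at x) x).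
exact: (is_diff_eq h).
Qed.

Lemma has_tangent_map_id (x : M) : has_tangent_map (id : M -> M) x x id.
Proof.
split=> //.
apply: near_eq_is_diff (is_diff_id _).
by apply: filterS (chart_at_cod_nbhs x) => _ [z dz <-] /=; rewrite fwdK.
Qed.

(** The inner coordinate change [bwd \o fwd] at [y] is the identity only on the
    domain of the chart; the continuity of [f] at [x] makes the two coordinate
    expressions agree near [x], which is enough for derivatives. *)
Lemma has_tangent_map_comp (P : manifoldType R) (f : M -> N) (h : N -> P)
    x y z A B :
  has_tangent_map f x y A -> has_tangent_map h y z B ->
  has_tangent_map (h \o f) x z (B \o A).
Proof.
move=> [fxy fc fA] [hyz hc hB]; split=> /=; first by rewrite fxy.
  by apply: continuous_comp => //; rewrite fxy.
have E : (fwd (chart_at y) \o f \o bwd (chart_at x)) (fwd (chart_at x) x)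
    = fwd (chart_at y) y by rewrite /= fwdK ?fxy//; exact: chart_at_dom.
rewrite -E in hB.
apply: near_eq_is_diff (is_diff_comp fA hB).
have : nbhs (fwd (chart_at x) x)
    ((f \o bwd (chart_at x)) @^-1` dom (chart_at y)).
  apply: (cvg_comp _ _ (@bwd_chart_at_cvg M x) fc).
  by rewrite /= fxy; exact: chart_at_nbhs.
by apply: filterS => u /= du; rewrite fwdK.
Qed.

Lemma has_tangent_map_pair (P : manifoldType R) (f : M -> N) (h : M -> P)
    x y z A B :
  has_tangent_map f x y A -> has_tangent_map h x z B ->
  has_tangent_map (fun u => (f u, h u)) x (y, z) (fun v => (A v, B v)).
Proof.
move=> [fxy fc fA] [hxz hc hB]; split=> /=; first by rewrite fxy hxz.
  exact: cvg_pair.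
exact: is_diff_pair fA hB.
Qed.

(** [curve_through v] is an affine line in the chart, as long as the line stays
    in the open image of the chart. *)
Lemma has_tangent_map_curve_through (x : M) (v : tangent x) :
  has_tangent_map (curve_through v : R^o -> M) 0 x (fun e : R => e *: v).
Proof.
have dl : is_diff (0 : R^o) (fun e : R^o => fwd (chart_at x) x + e *: v : model M)
    (fun e : R => e *: v).
  have h := is_diffD (is_diff_cst (fwd (chart_at x) x) (0 : R^o))
    (is_diff_scalel (0 : R^o) (v : model M)).
  apply: (is_diff_eq h).
  by apply/funext => e; rewrite /= !fctE add0r.
have c0 : fwd (chart_at x) x + 0 *: v = fwd (chart_at x) x
  by rewrite scale0r addr0.
have lc : fwd (chart_at x) x + e *: v @[e --> (0 : R^o)] --> fwd (chart_at x) x.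
  have : {for 0, continuous (fun e : R^o => fwd (chart_at x) x + e *: v : model M)}.
    by case: dl => d _; exact: differentiable_continuous d.
  by rewrite /prop_for /continuous_at c0.
split.
- by rewrite /curve_through c0 fwdK//; exact: chart_at_dom.
- rewrite /prop_for /continuous_at {2}/curve_through c0.
  rewrite fwdK; last exact: chart_at_dom.
  exact: (cvg_comp _ _ lc (@bwd_chart_at_cvg M x)).
- apply: near_eq_is_diff dl.
  apply: (@filterS _ _ (nbhs_filter (0 : R^o)) _ _ _
    (lc _ (chart_at_cod_nbhs x))) => e /= [z dz E].
  by rewrite /curve_through -E fwdK.
Qed.

End Basic.

Lemma has_tangent_map_real (f : R^o -> R^o) (t : R) (df : R -> R) :
  is_diff (t : R^o) f df -> has_tangent_map f t (f t) df.
Proof.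
by move=> fd; split=> //; case: fd => /differentiable_continuous.
Qed.

Lemma has_tangent_map_is_Tmap (M N : manifoldType R) (f : M -> N) x y A :
  has_tangent_map f x y A -> has_tangent_map f x y (Tmap f x).
Proof. by move=> h; rewrite (TmapE h). Qed.

Lemma has_tangent_map_velocity (M : manifoldType R) (c : R -> M) x A :
  has_tangent_map (c : R^o -> M) 0 x A ->
  has_tangent_map (c : R^o -> M) 0 x (fun s : R => s *: A 1).
Proof.
move=> h; rewrite (_ : (fun s : R => s *: A 1) = A)//.
apply/funext => s; rewrite -(TmapE h) -linearZ.
by rewrite -[s *: 1]/(s * 1) mulr1.
Qed.

Lemma has_tangent_map_opp :
  has_tangent_map (fun s : R^o => - s : R^o) 0 (0 : R^o) (fun s : R => - s).
Proof.
have h : is_diff (0 : R^o) (- id : R^o -> R^o) (- id) by exact: is_diffN.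
by have := has_tangent_map_real h; rewrite /= !fctE oppr0.
Qed.

Lemma is_derive_tangent_map (f : R -> R) (t y : R) (df : R -> R) :
  has_tangent_map (f : R^o -> R^o) t y df ->
  is_derive (t : R^o) 1 (f : R^o -> R^o) (df 1).
Proof.
move=> [_ _ [fd <-]]; apply: DeriveDef; first exact/derivable1_diffP.
by rewrite deriveE.
Qed.

End TangentMaps.

(** * Total derivative of a map of four arguments *)

Section Chain4.
Context (R : realType) (A B : manifoldType R) (Phi : A -> B -> R -> R -> R).
Hypothesis Phi_smooth : smooth4 Phi.

Let F (q : A * B * R^o * R^o) : R^o := Phi q.1.1.1 q.1.1.2 q.1.2 q.2.

Let chain_total (C : manifoldType R) (p : C) (alpha : C -> A) (beta : C -> B)
    (sigma tau : C -> R^o) x y s t dalpha dbeta dsigma dtau :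
  has_tangent_map alpha p x dalpha -> has_tangent_map beta p y dbeta ->
  has_tangent_map sigma p s dsigma -> has_tangent_map tau p t dtau ->
  has_tangent_map
    (fun q => Phi (alpha q) (beta q) (sigma q) (tau q) : R^o) p
    (Phi x y s t : R^o)
    (fun v => Tmap F (x, y, s, t) (dalpha v, dbeta v, dsigma v, dtau v)).
Proof.
move=> ha hb hs ht.
have h := has_tangent_map_pair
  (has_tangent_map_pair (has_tangent_map_pair ha hb) hs) ht.
exact: (has_tangent_map_comp h (has_tangent_map_Tmap _ Phi_smooth)).
Qed.

(** The tangent map of [F] at a point is linear, so it is the sum of its
    restrictions to the four factors. Each restriction is identified with a
    partial derivative by feeding [chain_total] the identity on that factor and
    constants on the other three. *)
Lemma has_tangent_map_chain (C : manifoldType R) (p : C) (alpha : C -> A)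
    (beta : C -> B) (sigma tau : C -> R^o) x y s t dalpha dbeta dsigma dtau :
  has_tangent_map alpha p x dalpha -> has_tangent_map beta p y dbeta ->
  has_tangent_map sigma p s dsigma -> has_tangent_map tau p t dtau ->
  has_tangent_map
    (fun q => Phi (alpha q) (beta q) (sigma q) (tau q) : R^o) p
    (Phi x y s t : R^o)
    (fun v => D1 Phi x y s t (dalpha v) + D2 Phi x y s t (dbeta v) +
       D3 Phi x y s t * dsigma v + D4 Phi x y s t * dtau v).
Proof.
move=> ha hb hs ht.
suff -> : (fun v => D1 Phi x y s t (dalpha v) + D2 Phi x y s t (dbeta v) +
       D3 Phi x y s t * dsigma v + D4 Phi x y s t * dtau v) =
   (fun v => Tmap F (x, y, s, t) (dalpha v, dbeta v, dsigma v, dtau v)).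
  exact: chain_total.
have pairD (U V : zmodType) (u u' : U) (w w' : V) :
  (u, w) + (u', w') = (u + u', w + w') by [].
have pairZ (U V : lmodType R) (a : R) (u : U) (w : V) :
  a *: (u, w) = (a *: u, a *: w) by [].
pose T (v : model A) (w : model B) (a b : R) : R := Tmap F (x, y, s, t) (v, w, a, b).
have TE v w a b : T v w a b = T v 0 0 0 + T 0 w 0 0 + T 0 0 a 0 + T 0 0 0 b.
  rewrite /T -!linearD; congr (Tmap F _ _).
  by rewrite !pairD !addr0 !add0r.
have E1 v : D1 Phi x y s t v = T v 0 0 0.
  by rewrite /D1 /differential (TmapE (chain_total (has_tangent_map_id x)
    (has_tangent_map_cst x y) (has_tangent_map_cst x (s : R^o))
    (has_tangent_map_cst x (t : R^o)))).
have E2 v : D2 Phi x y s t v = T 0 v 0 0.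
  by rewrite /D2 /differential (TmapE (chain_total (has_tangent_map_cst y x)
    (has_tangent_map_id y) (has_tangent_map_cst y (s : R^o))
    (has_tangent_map_cst y (t : R^o)))).
have scal (a : R) (u : model (A * B * R^o * R^o)%type) :
    a * (Tmap F (x, y, s, t) u : R^o) = Tmap F (x, y, s, t) (a *: u).
  by rewrite linearZ.
have E3 a : D3 Phi x y s t * a = T 0 0 a 0.
  have := is_derive_tangent_map (chain_total (has_tangent_map_cst (s : R^o) x)
    (has_tangent_map_cst (s : R^o) y) (has_tangent_map_id (s : R^o))
    (has_tangent_map_cst (s : R^o) (t : R^o))).
  rewrite /D3 derive1E => -[_ ->]; rewrite mulrC scal; congr (Tmap F _ _).
  by rewrite !pairZ !scaler0 -[a *: 1]/(a * 1) mulr1.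
have E4 a : D4 Phi x y s t * a = T 0 0 0 a.
  have := is_derive_tangent_map (chain_total (has_tangent_map_cst (t : R^o) x)
    (has_tangent_map_cst (t : R^o) y) (has_tangent_map_cst (t : R^o) (s : R^o))
     (has_tangent_map_id (t : R^o))).
  rewrite /D4 derive1E => -[_ ->]; rewrite mulrC scal; congr (Tmap F _ _).
  by rewrite !pairZ !scaler0 -[a *: 1]/(a * 1) mulr1.
by apply/funext => v; rewrite E1 E2 E3 E4 -TE.
Qed.

End Chain4.

(** * Translations, actions and one-parameter subgroups *)

Section GroupMaps.
Context (R : realType) (G : lieGroupType R).

Lemma has_tangent_map_mull (g x : G) :
  has_tangent_map (fun h : G => (g * h)%g) x (g * x)%g
    (Tmap (fun h : G => (g * h)%g) x).
Proof.
have h := has_tangent_map_pair (has_tangent_map_cst x g) (has_tangent_map_id x).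
exact: has_tangent_map_is_Tmap
  (has_tangent_map_comp h (has_tangent_map_Tmap _ mulg_smooth)).
Qed.

Lemma has_tangent_map_mulr (g x : G) :
  has_tangent_map (fun h : G => (h * g)%g) x (x * g)%g
    (Tmap (fun h : G => (h * g)%g) x).
Proof.
have h := has_tangent_map_pair (has_tangent_map_id x) (has_tangent_map_cst x g).
exact: has_tangent_map_is_Tmap
  (has_tangent_map_comp h (has_tangent_map_Tmap _ mulg_smooth)).
Qed.

Lemma has_tangent_map_act (M : manifoldType R) (to : smooth_action G M)
    (h : G) (x : M) :
  has_tangent_map (fun k : G => to k x) h (to h x) (Tmap (fun k : G => to k x) h).
Proof.
have hp := has_tangent_map_pair (has_tangent_map_id h) (has_tangent_map_cst h x).
exact: has_tangent_map_is_Tmap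
  (has_tangent_map_comp hp (has_tangent_map_Tmap _ (act_smooth to))).
Qed.

Lemma has_tangent_map_TeL (g : G) :
  has_tangent_map (fun h : G => (g * h)%g) 1%g g (TeL g).
Proof. by have := has_tangent_map_mull g 1%g; rewrite mulg1. Qed.

Lemma has_tangent_map_TeR (g : G) :
  has_tangent_map (fun h : G => (h * g)%g) 1%g g (TeR g).
Proof. by have := has_tangent_map_mulr g 1%g; rewrite mul1g. Qed.

Definition left_trivialization (g : G) (v : tangent g) : lie_algebra G :=
  Tmap (fun h : G => (g^-1 * h)%g) g v.

(** The chain rule for [L_g \o L_(g^-1) = id]. Left translates of curves in the
    Lie algebra thus exhaust the variations of a curve in the group. *)
Lemma left_trivializationK (g : G) (v : tangent g) :
  TeL g (left_trivialization v) = v.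
Proof.
have h := has_tangent_map_mull g^-1%g g; rewrite mulVg in h.
have := has_tangent_map_comp h (has_tangent_map_TeL g).
have -> : (fun h => (g * h)%g) \o (fun h => (g^-1 * h)%g) = id :> (G -> G).
  by apply/funext => k /=; rewrite mulVKg.
by move=> /has_tangent_map_unique /(_ (has_tangent_map_id g)) /(congr1 (@^~ v)).
Qed.

Lemma left_trivialization0 (g : G) : left_trivialization (0 : tangent g) = 0.
Proof. exact: linear0. Qed.

Lemma TeL0 (g : G) : TeL g (0 : lie_algebra G) = 0.
Proof. exact: linear0. Qed.

Section Exponential.
Context (expG : lie_algebra G -> G) (hexp : is_exponential expG).

Lemma expG0 : expG 0 = 1%g.
Proof.
have [_ hD _] := hexp 0; have := hD 0 0.
by rewrite !scaler0 => E; apply: (@mulgI G (expG 0)); rewrite mulg1 -E.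
Qed.

Lemma expGV (eta : lie_algebra G) (s : R) :
  ((expG (s *: eta))^-1)%g = expG (- s *: eta).
Proof.
have [_ hD _] := hexp eta; have := hD s (- s).
by rewrite subrr scale0r expG0 => /esym /mulg1_eq.
Qed.

Lemma has_tangent_map_expG (eta : lie_algebra G) :
  has_tangent_map (fun s : R^o => expG (s *: eta)) 0 1%g (fun s : R => s *: eta).
Proof.
have [hs _ hv] := hexp eta.
have := has_tangent_map_velocity (has_tangent_map_Tmap (0 : R^o) hs).
have hv1 : Tmap (fun s : R^o => expG (s *: eta)) 0 1 = eta := hv.
by rewrite hv1 scale0r expG0.
Qed.

(** Inversion on a one-parameter subgroup is the reversal of time; this avoids
    computing the tangent map of the inversion of the whole group. *)
Lemma has_tangent_map_expGV (eta : lie_algebra G) :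
  has_tangent_map (fun s : R^o => ((expG (s *: eta))^-1)%g) 0 1%g
    (fun s : R => s *: - eta).
Proof.
have := has_tangent_map_comp (has_tangent_map_opp R) (has_tangent_map_expG eta).
under [fun s : R^o => (_^-1)%g]eq_fun do rewrite expGV.
by under [fun s : R => s *: - eta]eq_fun do rewrite scalerN -scaleNr.
Qed.

Lemma has_tangent_map_actV (M : manifoldType R) (to : smooth_action G M)
    (eta : lie_algebra G) (x : M) :
  has_tangent_map (fun s : R^o => to (expG (s *: eta))^-1%g x) 0 x
    (fun s : R => s *: - inf_generator expG to eta x).
Proof.
have h1 : has_tangent_map (fun s : R^o => to (expG (s *: eta)) x) 0 x
    (fun s : R => s *: inf_generator expG to eta x).
  have := has_tangent_map_comp (has_tangent_map_expG eta)
    (has_tangent_map_act to 1%g x).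
  rewrite act1 => /has_tangent_map_is_Tmap /has_tangent_map_velocity; exact.
have := has_tangent_map_comp (has_tangent_map_opp R) h1.
under [fun s : R^o => to (_^-1)%g _]eq_fun do rewrite expGV.
by under [fun s : R => s *: - _]eq_fun do rewrite scalerN -scaleNr.
Qed.

End Exponential.
End GroupMaps.

(** * Derivatives of a map and of its reduced map *)

Section ReducedDerivatives.
Context (R : realType) (G : lieGroupType R) (expG : lie_algebra G -> G).
Hypothesis hexp : is_exponential expG.
Context (M : manifoldType R) (to : smooth_action G M) (aref : M).
Context (O : orbit_manifold to aref).
Context (Phi : G -> G -> R -> R -> R) (phi : G -> O -> R -> R -> R).
Hypotheses (Phi_smooth : smooth4 Phi) (phi_reduced : is_reduced_map Phi phi).
Context (g0 g1 : G) (s t : R).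

Let Xi : G := (g0^-1 * g1)%g.
Let a : O := orb_pt O g0.

Lemma orb_ptM (h k : G) : orb_pt O (h * k)%g = orb_act O k^-1%g (orb_pt O h).
Proof. by rewrite /orb_pt invgM actM. Qed.

(** Moving the first endpoint [g0] along [g0 exp (s eta)] moves both [Xi] and [a],
    by the left action of [exp (s eta)^-1]; this is where the minus signs of the
    Euler-Poincare constraints come from. *)
Lemma D1_reduced (eta : lie_algebra G) :
  D1 Phi g0 g1 s t (TeL g0 eta) =
  D1 phi Xi a s t (- TeR Xi eta) +
  D2 phi Xi a s t (- inf_generator expG (orb_act O) eta a).
Proof.
have [phi_smooth phiE] := phi_reduced.
have cst (N : manifoldType R) (y : N) := has_tangent_map_cst (0 : R^o) y.
have hu := has_tangent_map_chain Phi_smooth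
  (has_tangent_map_comp (has_tangent_map_expG hexp eta) (has_tangent_map_TeL g0))
  (cst G g1) (cst R^o s) (cst R^o t).
have hr := has_tangent_map_chain phi_smooth
  (has_tangent_map_comp (has_tangent_map_expGV hexp eta) (has_tangent_map_TeR Xi))
  (has_tangent_map_actV hexp (orb_act O) eta a) (cst R^o s) (cst R^o t).
rewrite phiE in hr.
have E : (fun q : R^o => phi ((expG (q *: eta))^-1 * Xi)%g
      (orb_act O (expG (q *: eta))^-1%g a) s t : R^o) =
    (fun q : R^o => Phi (g0 * expG (q *: eta))%g g1 s t : R^o).
  by apply/funext => q; rewrite -phiE orb_ptM invgM mulgA.
rewrite /= E in hr.
have /(congr1 (@^~ (1 : R))) := has_tangent_map_unique hu hr.
rewrite /= !mulr0 !addr0 !scale1r.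
rewrite (linear0 (D2 Phi g0 g1 s t)) addr0 => ->.
by congr (D1 _ _ _ _ _ _ + _); exact: linearN.
Qed.

(** The second endpoint [g1] enters the reduced variables only through [Xi]. *)
Lemma D2_reduced (eta : lie_algebra G) :
  D2 Phi g0 g1 s t (TeL g1 eta) = D1 phi Xi a s t (TeL Xi eta).
Proof.
have [phi_smooth phiE] := phi_reduced.
have cst (N : manifoldType R) (y : N) := has_tangent_map_cst (1%g : G) y.
have hu := has_tangent_map_chain Phi_smooth
  (cst G g0) (has_tangent_map_TeL g1) (cst R^o s) (cst R^o t).
have hr := has_tangent_map_chain phi_smooth
  (has_tangent_map_TeL Xi) (cst O a) (cst R^o s) (cst R^o t).
rewrite phiE in hr.
have E : (fun q : G => phi (Xi * q)%g a s t : R^o) =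
    (fun q : G => Phi g0 (g1 * q)%g s t : R^o).
  by apply/funext => q; rewrite -phiE mulgA.
rewrite /= E in hr.
have /(congr1 (@^~ eta)) := has_tangent_map_unique hu hr.
rewrite /= !mulr0 !addr0.
by rewrite (linear0 (D1 Phi g0 g1 s t)) add0r (linear0 (D2 phi Xi a s t)) addr0.
Qed.

Lemma D3_reduced : D3 phi Xi a s t = D3 Phi g0 g1 s t.
Proof.
by rewrite /D3; congr derive1; apply/funext => s'; rewrite phi_reduced.2.
Qed.

Lemma D4_reduced : D4 phi Xi a s t = D4 Phi g0 g1 s t.
Proof.
by rewrite /D4; congr derive1; apply/funext => t'; rewrite phi_reduced.2.
Qed.

End ReducedDerivatives.

(** * First variation of the discrete action *)

Section ActionDerivative.
Context (R : realType) (A B : manifoldType R) (Phi : A -> B -> R -> R -> R).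
Hypothesis Phi_smooth : smooth4 Phi.
Context (x : nat -> A) (y : nat -> B) (S : nat -> R).
Context (v : forall k, tangent (x k)) (w : forall k, tangent (y k)).
Context (dS : nat -> R) (N : nat).

Lemma derive1_action :
  derive1 (fun e : R => \sum_(0 <= k < N)
     Phi (curve_through (v k) e) (curve_through (w k) e)
       (S k + e * dS k) (S k.+1 + e * dS k.+1)) 0 =
  \sum_(0 <= k < N)
    (D1 Phi (x k) (y k) (S k) (S k.+1) (v k) +
     D2 Phi (x k) (y k) (S k) (S k.+1) (w k) +
     D3 Phi (x k) (y k) (S k) (S k.+1) * dS k +
     D4 Phi (x k) (y k) (S k) (S k.+1) * dS k.+1).
Proof.
have hl (k : nat) : has_tangent_map (fun e : R^o => S k + e * dS k : R^o) 0
    (S k : R^o) (fun e : R => e *: dS k).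
  exact: has_tangent_map_curve_through (dS k : tangent (S k : R^o)).
have hk (k : nat) := is_derive_tangent_map (has_tangent_map_chain Phi_smooth
  (has_tangent_map_curve_through (v k)) (has_tangent_map_curve_through (w k))
  (hl k) (hl k.+1)).
have hs := is_derive_sum (fun i : 'I_N => hk i).
rewrite !big_mkord derive1E.
rewrite (_ : (fun e : R => _) = \sum_(i < N) (fun e : R^o =>
    Phi (curve_through (v i) e) (curve_through (w i) e)
       (S i + e * dS i) (S i.+1 + e * dS i.+1) : R^o)); last first.
  by apply/funext => e; rewrite fct_sumE big_mkord.
case: hs => _ ->; apply: eq_bigr => i _.
by rewrite !scale1r.
Qed.

End ActionDerivative.

Lemma discrete_sum_by_parts (V : nmodType) (N : nat) (A B : nat -> V) :
  A 0%N = 0 -> B N = 0 ->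
  \sum_(0 <= k < N) (A k + B k.+1) = \sum_(1 <= k < N) (A k + B k).
Proof.
case: N => [|n] A0 BN; first by rewrite !big_geq.
rewrite !big_split/=; congr (_ + _); first by rewrite big_ltn// A0 add0r.
by rewrite big_nat_recr//= BN addr0 [RHS]big_add1.
Qed.

Section Unreduced.
Context (R : realType) (G : lieGroupType R).
Context (N : nat) (L P : G -> G -> R -> R -> R) (Fext Ffr : discrete_force G).
Context (g : nat -> G) (S : nat -> R).
Hypothesis L_smooth : smooth4 L.

Definition force_balance (k : nat) (v : tangent (g k)) : R :=
  D1 L (g k) (g k.+1) (S k) (S k.+1) v +
  D2 L (g k.-1) (g k) (S k.-1) (S k) v +
  (fminus Fext (g k) (g k.+1) (S k) (S k.+1) v +
   fminus Ffr (g k) (g k.+1) (S k) (S k.+1) v) +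
  (fplus Fext (g k.-1) (g k) (S k.-1) (S k) v +
   fplus Ffr (g k.-1) (g k) (S k.-1) (S k) v).

Lemma force_balance0 (k : nat) : force_balance (0 : tangent (g k)) = 0.
Proof.
have sum0 (u1 u2 u3 u4 u5 u6 : R) : u1 = 0 -> u2 = 0 -> u3 = 0 -> u4 = 0 ->
    u5 = 0 -> u6 = 0 -> u1 + u2 + (u3 + u4) + (u5 + u6) = 0.
  by move=> -> -> -> -> -> ->; rewrite !addr0.
by apply: sum0; exact: linear0.
Qed.

(** The variational constraint replaces the derivatives in the entropy directions
    by the work of the friction forces, after which each term of the sum over
    the edges [(k, k.+1)] involves [dg k] and [dg k.+1] only; collecting the
    terms by vertex gives the balances. *)
Lemma first_variation (dg : forall k, tangent (g k)) (dS : nat -> R) :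
  dg 0%N = 0 -> dg N = 0 -> variational_constraint N L Ffr S dg dS ->
  delta_action N L S dg dS +
  \sum_(0 <= k < N)
    (fminus Fext (g k) (g k.+1) (S k) (S k.+1) (dg k) +
     fplus Fext (g k) (g k.+1) (S k) (S k.+1) (dg k.+1)) =
  \sum_(1 <= k < N) force_balance (dg k).
Proof.
move=> dg0 dgN hc; rewrite /delta_action.
rewrite (derive1_action L_smooth S dg (fun k => dg k.+1)) -big_split/=.
(* A and B collect what the edges starting and ending at k contribute. *)
pose A k := D1 L (g k) (g k.+1) (S k) (S k.+1) (dg k) +
  fminus Fext (g k) (g k.+1) (S k) (S k.+1) (dg k) +
  fminus Ffr (g k) (g k.+1) (S k) (S k.+1) (dg k).
pose B k := D2 L (g k.-1) (g k) (S k.-1) (S k) (dg k) +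
  fplus Fext (g k.-1) (g k) (S k.-1) (S k) (dg k) +
  fplus Ffr (g k.-1) (g k) (S k.-1) (S k) (dg k).
transitivity (\sum_(0 <= k < N) (A k + B k.+1)).
  apply: eq_big_nat => k /andP[_ kN].
  by rewrite -[_ + D3 _ _ _ _ _ * _ + _]addrA hc// /A /B /=; ring.
rewrite discrete_sum_by_parts.
- apply: eq_bigr => k _; rewrite /A /B /force_balance.
  by rewrite [LHS]addrACA [X in X + _]addrACA -addrA [X in _ + X]addrACA addrA.
- by rewrite /A dg0 !linear0 !addr0.
- by rewrite /B dgN !linear0 !addr0.
Qed.

Lemma discrete_equations_critical :
  discrete_equations N L P Fext Ffr g S -> critical N L P Fext Ffr g S.
Proof.
move=> [heq hP]; split=> // dg dS dg0 dgN hc.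
rewrite first_variation//; apply: big1_seq => k /=.
by rewrite mem_index_iota => /heq; exact.
Qed.

Lemma critical_discrete_equations :
  variations_admissible N L Ffr g S ->
  critical N L P Fext Ffr g S -> discrete_equations N L P Fext Ffr g S.
Proof.
move=> hadm [hcrit hP]; split=> // k /andP[k0 kN] v.
(* A variation concentrated at k isolates the balance at k. *)
pose dg j : tangent (g j) := if j == k then v else 0.
have dg0 : dg 0%N = 0 by rewrite /dg eq_sym gtn_eqF.
have dgN : dg N = 0 by rewrite /dg gtn_eqF.
have [dS hc] := hadm dg dg0 dgN.
have := hcrit dg dS dg0 dgN hc; rewrite first_variation//.
rewrite (bigD1_seq k) ?iota_uniq ?mem_index_iota ?k0//= big1 ?addr0.
  by rewrite /dg eqxx.
move=> j /negPf jk.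
by rewrite /dg jk force_balance0.
Qed.

End Unreduced.

(** * Equivalence with the reduced formulations *)

Section Equivalence.
Context (R : realType) (G : lieGroupType R) (expG : lie_algebra G -> G).
Hypothesis hexp : is_exponential expG.
Context (M : manifoldType R) (to : smooth_action G M) (aref : M).
Context (O : orbit_manifold to aref).
Context (L P : G -> G -> R -> R -> R) (Fext Ffr : discrete_force G).
Context (l p : G -> O -> R -> R -> R) (fext ffr : reduced_force G O).
Hypotheses (L_smooth : smooth4 L) (l_reduced : is_reduced_map L l)
  (p_reduced : is_reduced_map P p)
  (fext_reduced : is_reduced_force Fext fext)
  (ffr_reduced : is_reduced_force Ffr ffr).
Context (N : nat) (g : nat -> G) (S : nat -> R).

Let Xi (k : nat) : G := ((g k)^-1 * g k.+1)%g.
Let a (k : nat) : O := orb_pt O (g k).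

Lemma reduced_phenomenologicalE :
  reduced_phenomenological N p Xi a S <-> phenomenological N P g S.
Proof.
by split=> h k kN; move: (h k kN); rewrite p_reduced.2.
Qed.

Section Variation.
Context (eta : nat -> lie_algebra G) (dS : nat -> R).
Let dg k : tangent (g k) := TeL (g k) (eta k).

Lemma reduced_variational_constraintE :
  reduced_variational_constraint N l ffr Xi a S eta dS <->
  variational_constraint N L Ffr S dg dS.
Proof.
split=> h k kN; move: (h k kN);
  have [em _] := ffr_reduced (g k) (g k.+1) (S k) (S k.+1) (eta k);
  have [_ ep] := ffr_reduced (g k) (g k.+1) (S k) (S k.+1) (eta k.+1);
  by rewrite (D3_reduced l_reduced) (D4_reduced l_reduced) em ep.
Qed.

(** The terms [- TeR Xi eta_k] and [TeL Xi eta_(k+1)] of the Euler-Poincare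
    variation of [Xi] come from moving [g k] and [g k.+1], respectively. *)
Lemma reduced_delta_actionE (dXi : forall k, tangent (Xi k))
    (da : forall k, tangent (a k)) :
  (forall k, (k < N)%N ->
     dXi k = - TeR (Xi k) (eta k) + TeL (Xi k) (eta k.+1) /\
     da k = - inf_generator expG (orb_act O) (eta k) (a k)) ->
  reduced_delta_action N l S dXi da dS = delta_action N L S dg dS.
Proof.
move=> hEP; rewrite /reduced_delta_action /delta_action.
rewrite (derive1_action l_reduced.1 S dXi da).
rewrite (derive1_action L_smooth S dg (fun k => dg k.+1)).
apply: eq_big_nat => k /andP[_ kN]; have [-> ->] := hEP k kN.
rewrite (D3_reduced l_reduced) (D4_reduced l_reduced) /dg.
rewrite (D1_reduced hexp L_smooth l_reduced) (D2_reduced L_smooth l_reduced).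
rewrite (linearD (D1 l _ _ _ _)) /=; congr (_ + _ + _).
by rewrite addrAC.
Qed.

Lemma reduced_external_workE :
  \sum_(0 <= k < N)
    (rminus fext (Xi k) (a k) (S k) (S k.+1) (eta k) +
     rplus fext (Xi k) (a k) (S k) (S k.+1) (eta k.+1)) =
  \sum_(0 <= k < N)
    (fminus Fext (g k) (g k.+1) (S k) (S k.+1) (dg k) +
     fplus Fext (g k) (g k.+1) (S k) (S k.+1) (dg k.+1)).
Proof.
apply: eq_bigr => k _.
have [e1 _] := fext_reduced (g k) (g k.+1) (S k) (S k.+1) (eta k).
have [_ e2] := fext_reduced (g k) (g k.+1) (S k) (S k.+1) (eta k.+1).
by rewrite e1 e2.
Qed.

End Variation.

(** Left trivialization is a correspondence between the admissible variations on
    both sides, since it is onto and preserves vanishing at the endpoints. *)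
Lemma critical_reduced_critical :
  critical N L P Fext Ffr g S <-> reduced_critical expG N l p fext ffr Xi a S.
Proof.
split=> -[hcrit /reduced_phenomenologicalE hP]; split=> //.
  move=> eta dXi da dS eta0 etaN hEP hc.
  rewrite (reduced_delta_actionE _ hEP) reduced_external_workE.
  apply: hcrit; rewrite ?eta0 ?etaN ?TeL0//.
  exact/reduced_variational_constraintE.
move=> dg dS dg0 dgN hc.
pose eta k := left_trivialization (dg k).
have dgE : dg = fun k => TeL (g k) (eta k).
  by apply/functional_extensionality_dep => k; rewrite left_trivializationK.
rewrite dgE in hc *.
rewrite -reduced_external_workE.
rewrite -(@reduced_delta_actionE _ _
  (fun k => - TeR (Xi k) (eta k) + TeL (Xi k) (eta k.+1))
  (fun k => - inf_generator expG (orb_act O) (eta k) (a k)))//.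
apply: hcrit => //; rewrite ?/eta ?dg0 ?dgN ?left_trivialization0//.
exact/reduced_variational_constraintE.
Qed.

(** On [TeL (g k) eta] the balance at [k] is the difference of the two sides of the
    Euler-Poincare equation at [k]; as [TeL (g k)] is onto, one vanishes
    identically if and only if the other does. The equation
    [a k.+1 = (Xi k)^-1 a k] holds by definition of [Xi] and [a]. *)
Lemma discrete_equations_euler_poincare :
  discrete_equations N L P Fext Ffr g S <->
  discrete_euler_poincare expG N l p fext ffr Xi a S.
Proof.
have balanceE k (eta : lie_algebra G) : (0 < k)%N ->
  force_balance L Fext Ffr S (TeL (g k) eta) =
    D1 l (Xi k.-1) (a k.-1) (S k.-1) (S k) (TeL (Xi k.-1) eta) -
    J expG (orb_act O) (D2 l (Xi k) (a k) (S k) (S k.+1)) eta +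
    (rminus fext (Xi k) (a k) (S k) (S k.+1) eta +
     rminus ffr (Xi k) (a k) (S k) (S k.+1) eta) +
    (rplus fext (Xi k.-1) (a k.-1) (S k.-1) (S k) eta +
     rplus ffr (Xi k.-1) (a k.-1) (S k.-1) (S k) eta) -
    D1 l (Xi k) (a k) (S k) (S k.+1) (TeR (Xi k) eta).
  case: k => [//|k] _ /=.
  have [e1 _] := fext_reduced (g k.+1) (g k.+2) (S k.+1) (S k.+2) eta.
  have [_ e2] := fext_reduced (g k) (g k.+1) (S k) (S k.+1) eta.
  have [e3 _] := ffr_reduced (g k.+1) (g k.+2) (S k.+1) (S k.+2) eta.
  have [_ e4] := ffr_reduced (g k) (g k.+1) (S k) (S k.+1) eta.
  have d1 := D1_reduced hexp L_smooth l_reduced (g k.+1) (g k.+2)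
    (S k.+1) (S k.+2) eta.
  have d2 := D2_reduced L_smooth l_reduced (g k) (g k.+1) (S k) (S k.+1) eta.
  rewrite (linearN (D1 l _ _ _ _)) (linearN (D2 l _ _ _ _)) in d1.
  have rearrange (u1 u2 f1 f2 f3 f4 x y z r1 r2 r3 r4 : R) :
      u1 = - x + - y -> u2 = z -> r1 = f1 -> r2 = f2 -> r3 = f3 -> r4 = f4 ->
    u1 + u2 + (f1 + f2) + (f3 + f4) = z - y + (r1 + r2) + (r3 + r4) - x.
    by move=> -> -> -> -> -> ->; ring.
  exact: rearrange d1 d2 e1 e3 e2 e4.
split=> [[heq /reduced_phenomenologicalE hP]|].
  split=> // [k k0N eta|k _]; last by rewrite -orb_ptM mulVKg.
  have /andP[k0 _] := k0N.
  have := heq k k0N (TeL (g k) eta).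
  rewrite -/(force_balance _ _ _ _ _) balanceE//.
  by move/eqP; rewrite subr_eq0 => /eqP ->.
move=> [heq /reduced_phenomenologicalE hP _]; split=> // k k0N v.
have /andP[k0 _] := k0N.
rewrite -(left_trivializationK v) -/(force_balance _ _ _ _ _) balanceE//.
by rewrite -heq// subrr.
Qed.

End Equivalence.

Theorem theorem2p3 (R : realType) (G : lieGroupType R)
    (expG : lie_algebra G -> G) (hexp : is_exponential expG)
    (M : manifoldType R) (to : smooth_action G M) (aref : M)
    (O : orbit_manifold to aref)
    (L P : G -> G -> R -> R -> R) (Fext Ffr : discrete_force G)
    (L_smooth : smooth4 L) (P_smooth : smooth4 P)
    (L_invariant : isotropy_invariant to aref L) (P_invariant : isotropy_invariant to aref P)
    (Fext_equivariant : isotropy_equivariant to aref Fext)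
    (Ffr_equivariant : isotropy_equivariant to aref Ffr)
    (l p : G -> O -> R -> R -> R) (fext ffr : reduced_force G O)
    (l_reduced : is_reduced_map L l) (p_reduced : is_reduced_map P p)
    (fext_reduced : is_reduced_force Fext fext)
    (ffr_reduced : is_reduced_force Ffr ffr)
    (N : nat) (g : nat -> G) (S : nat -> R) :
  let Xi := fun k : nat => ((g k)^-1 * g k.+1)%g in
  let a := fun k : nat => orb_pt O (g k) in
  let assertion1 := critical N L P Fext Ffr g S in
  let assertion2 := discrete_equations N L P Fext Ffr g S in
  let assertion3 := reduced_critical expG N l p fext ffr Xi a S in
  let assertion4 := discrete_euler_poincare expG N l p fext ffr Xi a S in
  [/\ assertion1 <-> assertion3,
      assertion2 <-> assertion4,
      assertion2 -> assertion1 &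
      variations_admissible N L Ffr g S ->
      [<-> assertion1; assertion2; assertion3; assertion4]].
Proof.
move=> Xi a assertion1 assertion2 assertion3 assertion4.
have h13 : assertion1 <-> assertion3 by exact: critical_reduced_critical.
have h24 : assertion2 <-> assertion4
  by exact: discrete_equations_euler_poincare.
have h21 : assertion2 -> assertion1 by exact: discrete_equations_critical.
split=> // hadm.
have h12 : assertion1 -> assertion2 by exact: critical_discrete_equations.
tfae; tauto.
Qed.
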